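(* Let $\Gamma\in\mathbb R^{P\times n}$ with $P\ge n$. If $\Gamma$ has full column rank and the constraint gradients $\nabla I_1(\mathbf q),\nabla I_2(\mathbf q),\dots,\nabla I_m(\mathbf q)\in\mathbb R^n$ are linearly independent, then the minimizer $\dot{\mathbf q}$ of the constrained optimization problem $$\min_{\dot{\mathbf q}\in\mathbb R^n}\ \|\tilde M\dot{\mathbf q}-\tilde{\mathbf f}\|_2^2+\|\Gamma\dot{\mathbf q}\|_2^2,$$ $$\text{subject to}\quad I_k(\mathbf q(t))=I_k(\mathbf q(0)),\quad k=1,2,\dots,m,\ \forall t\ge0,$$ satisfies $$\big(\tilde M^\top\tilde M+\Gamma^\top\Gamma\big)\dot{\mathbf q}=\tilde M^\top\tilde{\mathbf f}-\sum_{k=1}^m\tilde\lambda_k\nabla I_k(\mathbf q).$$ The Lagrange multipliers $\tilde{\boldsymbol\lambda}=(\tilde\lambda_1,\dots,\tilde\lambda_m)^\top$ are determined through the linear system $$\tilde C(\mathbf q)\,\tilde{\boldsymbol\lambda}=\tilde{\mathbf b}(\mathbf q),$$ where $\tilde C\in\mathbb R^{m\times m}$ has entries $$\tilde C_{ij}=\big\langle\nabla I_j,(\tilde M^\top\tilde M+\Gamma^\top\Gamma)^{-1}\nabla I_i\big\rangle,\quad i,j\in\{1,\dots,m\},$$ and $\tilde{\mathbf b}=(\tilde b_1,\dots,\tilde b_m)^\top\in\mathbb R^m$ is given by $$\tilde b_i=\big\langle\nabla I_i,(\tilde M^\top\tilde M+\Gamma^\top\Gamma)^{-1}\tilde M^\top\tilde{\mathbf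 f}\big\rangle,\quad i=1,\dots,m.$$
   Context: Setting: $H$ is a real Hilbert space of functions on a domain $D\subseteq\mathbb R^d$. $F$ is a (possibly nonlinear) differential operator, the right-hand side of the PDE $\partial u/\partial t=F(u)$. $\hat u(\mathbf x,\mathbf q)\in\mathbb R$ is an approximate solution depending smoothly on time-dependent parameters $\mathbf q=\mathbf q(t)=(q_1,\dots,q_n)\in\mathbb R^n$, with $\hat u(\cdot,\mathbf q)\in H$. Given collocation points $\mathbf x_1,\dots,\mathbf x_N\in D$, the collocation matrix $\tilde M=\tilde M(\mathbf q)\in\mathbb R^{N\times n}$ and vector $\tilde{\mathbf f}=\tilde{\mathbf f}(\mathbf q)\in\mathbb R^N$ are $$\tilde M_{ij}(\mathbf q)=\frac{\partial\hat u}{\partial q_j}(\mathbf x_i,\mathbf q),\qquad \tilde f_i(\mathbf q)=F(\hat u(\cdot,\mathbf q))\big|_{\mathbf x=\mathbf x_i},\qquad i\in\{1,\dots,N\},\ j\in\{1,\dots,n\}.$$ No rank assumption is made on $\tilde M$. $I_1,\dots,I_m:H\to\mathbb R$ are conserved quantities of the PDE, $I_k(\mathbf q)$ is shorthand for $I_k(\hat u(\cdot,\mathbf q))$ (assumed differentiable in $\mathbf q$), and $\nabla I_k(\mathbf q)\in\mathbb R^n$ is the gradient with respect to $\mathbf q$. $\langle\cdot,\cdot\rangle$ and $\|\cdot\|_2$ denote the Euclidean inner product and norm. The minimization is over the instantaneous velocity $\dot{\mathbf q}\in\mathbb R^n$ at a given parameter value $\mathbf q$. The constraints $I_k(\mathbf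 q(t))=I_k(\mathbf q(0))$ for all $t\ge0$ are understood through their equivalent time-differentiated form, i.e. as the constraints $\langle\nabla I_k(\mathbf q),\dot{\mathbf q}\rangle=0$, $k=1,\dots,m$, on $\dot{\mathbf q}$. *)

(* Defs.v *)
From HB Require Import structures.
From mathcomp Require Import all_boot all_order all_algebra.
From mathcomp Require Import all_classical all_reals all_analysis.

Set Implicit Arguments.
Unset Strict Implicit.
Unset Printing Implicit Defensive.

Import Order.TTheory GRing.Theory Num.Theory.
Import numFieldNormedType.Exports.

Local Open Scope classical_set_scope.
Local Open Scope ring_scope.

(* The library norm on 'cV[R]_n is the sup norm, hence a separate Euclidean
   one. *)
Definition dotv (R : realType) (n : nat) (x y : 'cV[R]_n) : R :=
  \sum_(i < n) x i 0 * y i 0.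

Definition norm2 (R : realType) (n : nat) (x : 'cV[R]_n) : R :=
  Num.sqrt (dotv x x).

Definition partial (R : realType) (n : nat) (j : 'I_n) (f : 'cV[R]_n -> R) :
    'cV[R]_n -> R :=
  'D_(delta_mx j 0) f.

Definition partials (R : realType) (n : nat) (s : seq 'I_n)
    (f : 'cV[R]_n -> R) : 'cV[R]_n -> R :=
  foldr (@partial R n) f s.

Definition gradient (R : realType) (n : nat) (f : 'cV[R]_n -> R)
    (q : 'cV[R]_n) : 'cV[R]_n :=
  \col_j partial j f q.

(* Only meant for open A; 'D_v is total, so the existence of each partial
   derivative has to be requested explicitly. *)
Definition Ck_on (R : realType) (n : nat) (A : set 'cV[R]_n) (k : nat)
    (f : 'cV[R]_n -> R) : Prop :=
  forall (s : seq 'I_n) (x : 'cV[R]_n), A x ->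
    ((size s < k)%N -> differentiable (partials s f) x) /\
    ((size s <= k)%N -> {for x, continuous (partials s f)}).

Definition smooth (R : realType) (n : nat) (f : 'cV[R]_n -> R) : Prop :=
  forall k : nat, Ck_on setT k f.

Definition domain (R : realType) (d : nat) (D : set 'cV[R]_d) : Prop :=
  [/\ open D, connected D & D !=set0].

(* Functions on D are represented by total functions, of which only the values
   on D matter. H is a Hilbert space with inner product ip; V is the space of
   functions that represent its elements, and cls u is the element represented
   by u \in V. The map cls need not be injective modulo equality on D, so that
   both genuine function spaces and spaces of almost-everywhere classes such as
   L^2(D) are covered, while functions in V can still be evaluated at points. *)
Definition hilbert_function_space (R : realType) (d : nat) (D : set 'cV[R]_d)
    (H : completeNormedModType R) (ip : {dot H for idfun})
    (V : set ('cV[R]_d -> R)) (cls : ('cV[R]_d -> R) -> H) : Prop :=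
  [/\ forall h : H, ip h h = `|h| ^+ 2,
      V 0 /\ (forall (a : R) u v, V u -> V v -> V (a *: u + v)),
      forall (a : R) u v, V u -> V v -> cls (a *: u + v) = a *: cls u + cls v,
      forall h : H, exists2 u, V u & cls u = h
    & forall u v, (forall x, D x -> u x = v x) -> V u ->
        V v /\ cls u = cls v].

(* On functions of class C^r, F(u)(x) is a (possibly nonlinear) function G of x
   and of the partial derivatives of u at x of order at most r. *)
Definition differential_operator (R : realType) (d : nat) (D : set 'cV[R]_d)
    (r : nat) (F : ('cV[R]_d -> R) -> ('cV[R]_d -> R)) : Prop :=
  exists G : 'cV[R]_d -> (r.-bseq 'I_d -> R) -> R,
    forall u, Ck_on D r u ->
    forall x, D x -> F u x = G x (fun s => partials s u x).

(* Global-in-time solutions of du/dt = F(u); the time derivative holds both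
   pointwise on D and in the norm of H. *)
Definition pde_solution (R : realType) (d : nat) (D : set 'cV[R]_d)
    (H : completeNormedModType R)
    (V : set ('cV[R]_d -> R)) (cls : ('cV[R]_d -> R) -> H) (r : nat)
    (F : ('cV[R]_d -> R) -> ('cV[R]_d -> R)) (u : R -> 'cV[R]_d -> R) : Prop :=
  [/\ forall t : R, 0 <= t -> [/\ V (u t), Ck_on D r (u t) & V (F (u t))],
      {within [set t : R | 0 <= t], continuous (cls \o u)},
      forall t : R, 0 < t -> is_derive t (1 : R) (cls \o u) (cls (F (u t)))
    & forall (t : R) x, 0 < t -> D x -> is_derive t (1 : R) (u ^~ x) (F (u t) x)].

Definition conserved (R : realType) (d : nat) (D : set 'cV[R]_d)
    (H : completeNormedModType R)
    (V : set ('cV[R]_d -> R)) (cls : ('cV[R]_d -> R) -> H) (r : nat)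
    (F : ('cV[R]_d -> R) -> ('cV[R]_d -> R)) (J : H -> R) : Prop :=
  forall u, pde_solution D V cls r F u ->
  forall t : R, 0 <= t -> J (cls (u t)) = J (cls (u 0)).

Section Collocation.
Variables (R : realType) (d n N P m : nat).

Definition collocation_matrix (uhat : 'cV[R]_d -> 'cV[R]_n -> R)
    (X : 'I_N -> 'cV[R]_d) (q : 'cV[R]_n) : 'M[R]_(N, n) :=
  \matrix_(i, j) partial j (uhat (X i)) q.

Definition collocation_rhs (F : ('cV[R]_d -> R) -> ('cV[R]_d -> R))
    (uhat : 'cV[R]_d -> 'cV[R]_n -> R) (X : 'I_N -> 'cV[R]_d)
    (q : 'cV[R]_n) : 'cV[R]_N :=
  \col_i F (uhat ^~ q) (X i).

Definition regularized_gram (M : 'M[R]_(N, n)) (Gamma : 'M[R]_(P, n)) :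
    'M[R]_n :=
  M^T *m M + Gamma^T *m Gamma.

Definition multiplier_matrix (M : 'M[R]_(N, n)) (Gamma : 'M[R]_(P, n))
    (g : 'I_m -> 'cV[R]_n) : 'M[R]_m :=
  \matrix_(i, j) dotv (g j) (invmx (regularized_gram M Gamma) *m g i).

Definition multiplier_rhs (M : 'M[R]_(N, n)) (f : 'cV[R]_N)
    (Gamma : 'M[R]_(P, n)) (g : 'I_m -> 'cV[R]_n) : 'cV[R]_m :=
  \col_i dotv (g i) (invmx (regularized_gram M Gamma) *m (M^T *m f)).

(* The constraints on I_k(q(t)) enter in their time-differentiated form
   <g k, v> = 0 on the velocity v, where g k is the gradient of I_k at q. *)
Definition constrained_minimizer (M : 'M[R]_(N, n)) (f : 'cV[R]_N)
    (Gamma : 'M[R]_(P, n)) (g : 'I_m -> 'cV[R]_n) (v : 'cV[R]_n) : Prop :=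
  let cost w := norm2 (M *m w - f) ^+ 2 + norm2 (Gamma *m w) ^+ 2 in
  let feasible w := forall k, dotv (g k) w = 0 in
  feasible v /\ (forall w, feasible w -> cost v <= cost w).

End Collocation.

(* Main.v *)
Require Import Defs.
From HB Require Import structures.
From mathcomp Require Import all_boot all_order all_algebra.
From mathcomp Require Import all_classical all_reals all_analysis.
From mathcomp Require Import ring.

(** Write A = M^T M + Gamma^T Gamma, c = M^T f, and let B be the matrix whose
    columns are the constraint gradients, so that feasibility of a velocity w
    reads B^T w = 0.  Up to a constant the cost is the quadratic form
    <w, A w> - 2 <w, c>, and everything follows from positive definiteness.

    Since Gamma is injective, A is positive definite ([regularized_gram_posdef])
    and hence so are A^-1 ([posdef_invmx]) and, B being injective by linear
    independence of the gradients, the multiplier matrix C = B^T A^-1 B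
    ([posdef_congr]).  In particular A and C are invertible.

    Put b = B^T A^-1 c.  If A v = c - B lam, then B^T v = b - C lam, so v is
    feasible exactly when C lam = b ([stationary_feasible]).  If v is such a
    feasible stationary point and w is feasible, the cross term of the quadratic
    expansion of the cost around v is 2 <w - v, - B lam> = 0, whence
    cost w - cost v = <w - v, A (w - v)> ([cost_gap]).  Positive definiteness
    makes v the only minimizer.  Such a v exists: take lam = C^-1 b. *)

Set Implicit Arguments.
Unset Strict Implicit.
Unset Printing Implicit Defensive.

Import Order.TTheory GRing.Theory Num.Theory.
Import numFieldNormedType.Exports.

Local Open Scope classical_set_scope.
Local Open Scope ring_scope.

(** * The Euclidean inner product *)

Section EuclideanInnerProduct.
Variable R : realType.

Lemma dotvE n (x y : 'cV[R]_n) : dotv x y = (x^T *m y) 0 0.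
Proof. by rewrite mxE; apply: eq_bigr => i _; rewrite mxE. Qed.

Lemma dotvC n (x y : 'cV[R]_n) : dotv x y = dotv y x.
Proof. by apply: eq_bigr => i _; rewrite mulrC. Qed.

Lemma dotvDr n (x y z : 'cV[R]_n) : dotv x (y + z) = dotv x y + dotv x z.
Proof. by rewrite !dotvE mulmxDr mxE. Qed.

Lemma dotvDl n (x y z : 'cV[R]_n) : dotv (x + y) z = dotv x z + dotv y z.
Proof. by rewrite dotvC dotvDr !(dotvC z). Qed.

Lemma dotvNr n (x y : 'cV[R]_n) : dotv x (- y) = - dotv x y.
Proof. by rewrite !dotvE mulmxN mxE. Qed.

Lemma dotv_mull m n (S : 'M[R]_(m, n)) (x : 'cV[R]_n) (y : 'cV[R]_m) :
  dotv (S *m x) y = dotv x (S^T *m y).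
Proof. by rewrite !dotvE trmx_mul mulmxA. Qed.

Lemma sqr_dotvD n (x y : 'cV[R]_n) :
  dotv (x + y) (x + y) = dotv x x + 2%:R * dotv y x + dotv y y.
Proof. rewrite !dotvDl !dotvDr (dotvC x y); ring. Qed.

Lemma dotv_ge0 n (x : 'cV[R]_n) : 0 <= dotv x x.
Proof. by apply: sumr_ge0 => i _; rewrite -expr2 sqr_ge0. Qed.

Lemma dotv_gt0 n (x : 'cV[R]_n) : x != 0 -> 0 < dotv x x.
Proof.
move=> x0; rewrite lt_neqAle dotv_ge0 andbT eq_sym; apply: contra x0.
rewrite psumr_eq0 => [/allP x0|i _]; last by rewrite -expr2 sqr_ge0.
apply/eqP/matrixP => i j; rewrite (ord1 j) mxE; apply/eqP.
by have := x0 i (mem_index_enum i); rewrite /= mulf_eq0 orbb.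
Qed.

Lemma sqr_norm2 n (x : 'cV[R]_n) : norm2 x ^+ 2 = dotv x x.
Proof. by rewrite /norm2 sqr_sqrtr ?dotv_ge0. Qed.

End EuclideanInnerProduct.

(** * Positive definite matrices *)

Section PositiveDefinite.
Variable R : realType.

Definition posdefmx n (S : 'M[R]_n) : Prop :=
  S^T = S /\ forall x : 'cV[R]_n, x != 0 -> 0 < dotv x (S *m x).

Lemma unitmx_inj n (S : 'M[R]_n) :
  (forall x : 'cV[R]_n, S *m x = 0 -> x = 0) -> S \in unitmx.
Proof.
move=> Sinj; rewrite -unitmx_tr -row_free_unit -kermx_eq0.
apply/rowV0P => v /sub_kermxP vS0.
apply: (can_inj (@trmxK _ _ _)); rewrite trmx0; apply: Sinj.
by rewrite -[S]trmxK -trmx_mul vS0 trmx0.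
Qed.

Lemma posdef_unitmx n (S : 'M[R]_n) : posdefmx S -> S \in unitmx.
Proof.
move=> [_ Spos]; apply: unitmx_inj => x Sx0.
apply/eqP/negPn/negP => /Spos.
by rewrite Sx0 dotvE mulmx0 mxE ltxx.
Qed.

(** The substitution x = S y turns <x, S^-1 x> into <y, S y>. *)
Lemma posdef_invmx n (S : 'M[R]_n) : posdefmx S -> posdefmx (invmx S).
Proof.
move=> S_pd; have Su := posdef_unitmx S_pd; case: S_pd => S_sym Spos.
split=> [|x x0]; first by rewrite trmx_inv S_sym.
have y0 : invmx S *m x != 0.
  by apply: contra x0 => /eqP y0; rewrite -(mulKVmx Su x) y0 mulmx0.
by have := Spos _ y0; rewrite mulKVmx // dotvC.
Qed.

Lemma posdef_congr m n (S : 'M[R]_n) (B : 'M[R]_(n, m)) :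
  posdefmx S -> (forall x : 'cV[R]_m, B *m x = 0 -> x = 0) ->
  posdefmx (B^T *m S *m B).
Proof.
move=> [S_sym Spos] Binj; split=> [|x x0].
  by rewrite !trmx_mul trmxK S_sym mulmxA.
rewrite -!mulmxA -dotv_mull; apply: Spos.
by apply: contra x0 => /eqP /Binj ->.
Qed.

Lemma regularized_gram_posdef N P n (M : 'M[R]_(N, n)) (Gamma : 'M[R]_(P, n)) :
  \rank Gamma = n -> posdefmx (regularized_gram M Gamma).
Proof.
move=> Gamma_full; split=> [|x x0].
  by rewrite /regularized_gram linearD /= !trmx_mul !trmxK.
rewrite mulmxDl dotvDr -!mulmxA -!dotv_mull.
apply: ltr_wpDl; first exact: dotv_ge0.
apply: dotv_gt0; apply: contra x0 => /eqP Gx0.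
have /row_fullP[L LG] : row_full Gamma by apply/eqP.
by rewrite -(mul1mx x) -LG -mulmxA Gx0 mulmx0.
Qed.

End PositiveDefinite.

(** * Least squares under linear constraints *)

Section ConstrainedLeastSquares.
Variables (R : realType) (N P m n : nat).
Variables (M : 'M[R]_(N, n)) (f : 'cV[R]_N) (Gamma : 'M[R]_(P, n)).
Variable g : 'I_m -> 'cV[R]_n.

Local Notation A := (regularized_gram M Gamma).
Local Notation C := (multiplier_matrix M Gamma g).
Local Notation b := (multiplier_rhs M f Gamma g).
Local Notation cost w := (norm2 (M *m w - f) ^+ 2 + norm2 (Gamma *m w) ^+ 2).

Definition constraint_mx : 'M[R]_(n, m) := \matrix_(i, k) g k i 0.
Local Notation B := constraint_mx.

Lemma constraint_mx_mul (lam : 'cV[R]_m) :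
  B *m lam = \sum_k lam k 0 *: g k.
Proof.
apply/matrixP => i j; rewrite (ord1 j) mxE summxE.
by apply: eq_bigr => k _; rewrite !mxE mulrC.
Qed.

Lemma constraint_mx_tr_mul (w : 'cV[R]_n) k : (B^T *m w) k 0 = dotv (g k) w.
Proof. by rewrite mxE; apply: eq_bigr => i _; rewrite !mxE. Qed.

Lemma feasibleP (w : 'cV[R]_n) :
  (forall k, dotv (g k) w = 0) <-> B^T *m w = 0.
Proof.
split=> [gw0 | Bw0 k]; last by rewrite -constraint_mx_tr_mul Bw0 mxE.
by apply/matrixP => k j; rewrite (ord1 j) constraint_mx_tr_mul gw0 mxE.
Qed.

Lemma constraint_mx_inj :
  free [tuple g k | k < m] ->
  forall lam : 'cV[R]_m, B *m lam = 0 -> lam = 0.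
Proof.
move=> /freeP g_free lam; rewrite constraint_mx_mul => glam0.
apply/matrixP => k j; rewrite (ord1 j) mxE.
apply: (g_free (fun k => lam k 0)); rewrite -[RHS]glam0.
by apply: eq_bigr => i _; rewrite -tnth_nth tnth_mktuple.
Qed.

Lemma multiplier_rhsE : b = B^T *m (invmx A *m (M^T *m f)).
Proof.
by apply/matrixP => k j; rewrite (ord1 j) constraint_mx_tr_mul mxE.
Qed.

Hypothesis Gamma_full : \rank Gamma = n.

Let A_posdef : posdefmx A := regularized_gram_posdef M Gamma_full.
Let A_unit : A \in unitmx := posdef_unitmx A_posdef.

(** The entry (i, j) of C is that of the transpose of B^T A^-1 B; the symmetry
    of A^-1 reconciles the two. *)
Lemma multiplier_matrixE : C = B^T *m invmx A *m B.
Proof.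
have [Ai_sym _] := posdef_invmx A_posdef.
apply/matrixP => i j; rewrite mxE.
rewrite dotvC dotv_mull Ai_sym -constraint_mx_tr_mul mulmxA.
rewrite !mxE; apply: eq_bigr => k _; congr (_ * _).
by rewrite !mxE.
Qed.

Lemma multiplier_matrix_unit :
  free [tuple g k | k < m] -> C \in unitmx.
Proof.
move=> g_free; rewrite multiplier_matrixE; apply: posdef_unitmx.
by apply: posdef_congr (posdef_invmx A_posdef) (constraint_mx_inj g_free).
Qed.

(** Applying B^T A^-1 to the stationarity equation gives B^T v = b - C lam. *)
Lemma stationary_feasible (v : 'cV[R]_n) (lam : 'cV[R]_m) :
  A *m v = M^T *m f - B *m lam -> (B^T *m v = 0 <-> C *m lam = b).
Proof.
move=> Av; have -> : B^T *m v = b - C *m lam.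
  rewrite -(mulKmx A_unit v) Av multiplier_rhsE multiplier_matrixE.
  by rewrite !mulmxBr !mulmxA.
by split=> [/eqP | ->]; rewrite ?subrr // subr_eq0 => /eqP.
Qed.

Lemma cost_expansion (v h : 'cV[R]_n) :
  cost (v + h) =
  cost v + 2%:R * dotv h (A *m v - M^T *m f) + dotv h (A *m h).
Proof.
rewrite !sqr_norm2 !mulmxDr addrAC !sqr_dotvD /regularized_gram !mulmxDl.
rewrite [M^T *m M *m v + _ - _]addrAC -!mulmxA -mulmxBr.
rewrite !(dotvDr h) -!dotv_mull; ring.
Qed.

(** At a stationary point the gradient of the cost is a combination of the
    constraint gradients, hence orthogonal to every feasible displacement. *)
Lemma cost_gap (v w : 'cV[R]_n) (lam : 'cV[R]_m) :
  A *m v = M^T *m f - B *m lam -> B^T *m v = 0 -> B^T *m w = 0 ->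
  cost w = cost v + dotv (w - v) (A *m (w - v)).
Proof.
move=> Av Bv Bw; rewrite -[w in LHS](subrKC v) cost_expansion Av.
rewrite [_ - _ - _]addrAC subrr add0r dotvNr dotvC dotv_mull mulmxBr Bv Bw.
by rewrite subrr dotvE mulmx0 mxE oppr0 mulr0 addr0.
Qed.

Lemma stationary_minimizer (v : 'cV[R]_n) (lam : 'cV[R]_m) :
  A *m v = M^T *m f - B *m lam -> B^T *m v = 0 ->
  constrained_minimizer M f Gamma g v.
Proof.
move=> Av Bv; split=> [|w /feasibleP Bw]; first exact/feasibleP.
rewrite (cost_gap Av Bv Bw) lerDl.
have [->|h0] := eqVneq (w - v) 0; first by rewrite mulmx0 dotv_ge0.
by apply/ltW/(proj2 A_posdef).
Qed.

Lemma stationary_minimizer_unique (v w : 'cV[R]_n) (lam : 'cV[R]_m) :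
  A *m v = M^T *m f - B *m lam -> B^T *m v = 0 ->
  constrained_minimizer M f Gamma g w -> v = w.
Proof.
move=> Av Bv [/feasibleP Bw w_min]; apply/esym/eqP; rewrite -subr_eq0.
apply/negPn/negP => /(proj2 A_posdef); apply/negP; rewrite -leNgt.
by have /feasibleP/w_min := Bv; rewrite (cost_gap Av Bv Bw) gerDl.
Qed.

End ConstrainedLeastSquares.

(** * Collocation with conserved quantities *)

Theorem theorem4 (R : realType) (d n N P m r : nat)
    (D : set 'cV[R]_d) (hD : domain D)
    (H : completeNormedModType R) (ip : {dot H for idfun})
    (V : set ('cV[R]_d -> R)) (cls : ('cV[R]_d -> R) -> H)
    (hH : hilbert_function_space D ip V cls)
    (F : ('cV[R]_d -> R) -> ('cV[R]_d -> R))
    (hF : differential_operator D r F)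
    (uhat : 'cV[R]_d -> 'cV[R]_n -> R)
    (huV : forall q : 'cV[R]_n, V (uhat ^~ q))
    (hus : forall x : 'cV[R]_d, D x -> smooth (uhat x))
    (X : 'I_N -> 'cV[R]_d) (hX : forall i, D (X i))
    (J : 'I_m -> H -> R)
    (hJ : forall k, conserved D V cls r F (J k))
    (hJd : forall k (q : 'cV[R]_n),
       differentiable (fun p : 'cV[R]_n => J k (cls (uhat ^~ p))) q)
    (Gamma : 'M[R]_(P, n)) (hPn : (n <= P)%N) (hGamma : \rank Gamma = n)
    (q : 'cV[R]_n) :
  let M := collocation_matrix uhat X q in
  let f := collocation_rhs F uhat X q in
  let gradJ k := gradient (fun p : 'cV[R]_n => J k (cls (uhat ^~ p))) q in
  let A := regularized_gram M Gamma in
  let C := multiplier_matrix M Gamma gradJ in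
  let b := multiplier_rhs M f Gamma gradJ in
  free [tuple gradJ k | k < m] ->
  [/\ A \in unitmx,
      C \in unitmx,
      exists! dq : 'cV[R]_n, constrained_minimizer M f Gamma gradJ dq
    & forall dq : 'cV[R]_n, constrained_minimizer M f Gamma gradJ dq ->
      forall lam : 'cV[R]_m,
        A *m dq = M^T *m f - \sum_(k < m) lam k 0 *: gradJ k <->
        C *m lam = b].
Proof.
move=> M f gradJ A C b gradJ_free.
have A_unit : A \in unitmx.
  exact: posdef_unitmx (regularized_gram_posdef M hGamma).
have C_unit : C \in unitmx by exact: multiplier_matrix_unit.
pose B := constraint_mx gradJ.
pose v (lam : 'cV[R]_m) := invmx A *m (M^T *m f - B *m lam).
have Av lam : A *m v lam = M^T *m f - B *m lam by rewrite mulKVmx.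
have Bv lam : C *m lam = b -> B^T *m v lam = 0.
  by move/(stationary_feasible hGamma (Av lam)).
split=> //.
  have Bv0 := Bv _ (mulKVmx C_unit b).
  exists (v (invmx C *m b)); split.
    exact: stationary_minimizer (Av _) Bv0.
  by move=> w; apply: stationary_minimizer_unique (Av _) Bv0.
move=> dq dq_min lam; rewrite -constraint_mx_mul; split=> [Adq | Clam].
  by apply/(stationary_feasible hGamma Adq)/feasibleP; case: dq_min.
by rewrite -(stationary_minimizer_unique hGamma (Av lam) (Bv _ Clam) dq_min) Av.
Qed.
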